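(* Let $n\ge 1$ and let $\{Z(t_i)\}_{1\le i\le n}$ be jointly multivariate normal random variables. Set $r_{i,j}:=\mathbb{E}Z(t_i)Z(t_j)$, and suppose that: (centralization and normalization) $\mathbb{E}Z(t_i)=0$ and $\mathbb{E}Z(t_i)^2=1$ for all $1\le i\le n$; (no repeated variables) $|r_{i,j}|<1$ whenever $i\ne j$. Then for any $u\ge 0$ and any $H\ge 0$, $$\mathbb{P}\Bigl(\max_{1\le i\le n}Z(t_i)>u\Bigr)\ \ge\ \frac{H e^{-(u+H)^2/2}}{\sqrt{2\pi}}\sum_{m=1}^{n}\ \inf_{0\le h\le H}P(m,h),$$ where $$P(m,h):=\mathbb{P}\Biggl(V_j\le \frac{u-r_{j,m}(u+h)}{\sqrt{1-r_{j,m}^2}}\ \ \text{for all } 1\le j\le m-1\Biggr),$$ and, for each $m$, $V_j=V_{j,m}$ $(1\le j\le m-1)$ are jointly multivariate normal random variables with mean zero, variance one, and correlations $$\mathbb{E}V_jV_k=\frac{r_{j,k}-r_{j,m}r_{k,m}}{\sqrt{(1-r_{j,m}^2)(1-r_{k,m}^2)}}.$$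
   Context: For $m=1$ the condition defining $P(m,h)$ is empty, so $P(1,h)=1$. ''Jointly multivariate normal'' allows singular covariance matrices. *)

(* Defs.v *)
From HB Require Import structures.
From mathcomp Require Import all_boot all_order all_algebra.
From mathcomp Require Import all_classical all_reals all_analysis.

Set Implicit Arguments.
Unset Strict Implicit.
Unset Printing Implicit Defensive.

Import Order.TTheory GRing.Theory Num.Theory.
Import numFieldNormedType.Exports.

Local Open Scope classical_set_scope.
Local Open Scope ring_scope.

(* The law N(m, s^2).  The case s = 0 is the point mass at m; it has to be
   separated because [normal_prob m 0] is the uniform law on [0, 1]. *)
Definition gaussian_law (R : realType) (m s : R) : set R -> \bar R :=
  if s == 0 then \d_m else normal_prob m s.

Definition is_gaussian d (T : measurableType d) (R : realType)
    (P : probability T R) (X : T -> R) : Prop :=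
  exists m s : R, forall A : set R, measurable A ->
    P (X @^-1` A) = gaussian_law m s A.

(* Joint normality: every linear combination is normal, possibly degenerate, so
   that singular covariance matrices are allowed. *)
Definition jointly_gaussian d (T : measurableType d) (R : realType)
    (P : probability T R) (n : nat) (Z : 'I_n -> {RV P >-> R}) : Prop :=
  forall a : 'I_n -> R, is_gaussian P (fun x => \sum_(i < n) a i * Z i x).

Definition below (n : nat) (m : 'I_n) (j : 'I_m) : 'I_n :=
  widen_ord (ltnW (ltn_ord m)) j.

(* The correlation of Z_j and Z_k given Z_m, when r is the correlation matrix
   of Z. *)
Definition partial_corr (R : realType) (n : nat) (r : 'I_n -> 'I_n -> R)
    (j k m : 'I_n) : R :=
  (r j k - r j m * r k m) / Num.sqrt ((1 - r j m ^+ 2) * (1 - r k m ^+ 2)).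

(* Indices start at 0: for the first index m the condition is empty and the
   probability is 1. *)
Definition prob_below d (T : measurableType d) (R : realType)
    (P : probability T R) (n : nat) (r : 'I_n -> 'I_n -> R) (u : R)
    (m : 'I_n) (V : 'I_m -> {RV P >-> R}) (h : R) : \bar R :=
  P [set x | forall j : 'I_m,
    V j x <= (u - r (below j) m * (u + h)) / Num.sqrt (1 - r (below j) m ^+ 2)].

(* Main.v *)
(* The events "Z_m is the first coordinate exceeding u" partition
   {max Z > u}.  Given Z_m = u + h, the coordinates Z_j (j < m) are distributed
   as r_{j,m} (u + h) + sqrt(1 - r_{j,m}^2) V_j, so the m-th event has
   probability at least inf P(m, h) times P(u < Z_m <= u + H), and the normal
   density on ]u, u + H] is at least its value at u + H.

   Conditioning is replaced by an identity of laws: on the product of the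
   probability spaces of Z and V, the vector with coordinates
   r_{j,m} Z_m + sqrt(1 - r_{j,m}^2) V_j (j < m) and Z_m has the same linear
   forms in law as (Z_j)_{j <= m}, since both are centered normal with the same
   variance.  Equality of joint laws follows from the Cramer-Wold principle:
   linear forms determine the expectations of x |-> cos (w.x + b), hence those
   of all functions obtained from them by linear combinations and bounded
   pointwise limits.  This class is closed under products and, without Fourier
   inversion, contains the indicators of half-spaces: the iterates of
   y |-> (3 y - y^3) / 2 send sin (x / k) to its sign, which tends to the sign
   of x as k grows. *)
Require Import Defs.
From HB Require Import structures.
From mathcomp Require Import all_boot all_order all_algebra.
From mathcomp Require Import ring lra.
From mathcomp Require Import all_classical all_reals all_analysis.
From mathcomp Require Import measurable_realfun.
Import Order.TTheory GRing.Theory Num.Theory.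
Import numFieldNormedType.Exports.
Local Open Scope classical_set_scope.
Local Open Scope ring_scope.

Set Implicit Arguments.
Unset Strict Implicit.
Unset Printing Implicit Defensive.

(** * Bounded pointwise limits of trigonometric polynomials *)

Section trig_closure.
Context {R : realType} {I : finType}.
Implicit Types (F G : (I -> R) -> R) (w : I -> R) (b c : R).

(** An inductive predicate, because limits are taken of functions that are themselves limits. The
    uniform bound in [trig_lim] is what dominated convergence will need; the phase [b] makes sines
    available. *)
Inductive trig_closure : ((I -> R) -> R) -> Prop :=
| trig_cos w b : trig_closure (fun x => cos (\sum_i w i * x i + b))
| trig_lin c F G : trig_closure F -> trig_closure G ->
    trig_closure (fun x => c * F x + G x)
| trig_lim (F_ : nat -> (I -> R) -> R) F C :
    (forall n, trig_closure (F_ n)) -> (forall n x, `|F_ n x| <= C) ->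
    (forall x, F_ n x @[n --> \oo] --> F x) -> trig_closure F.

Lemma trig_eq F G : F =1 G -> trig_closure F -> trig_closure G.
Proof. by move=> /funext ->. Qed.

Lemma trig_cst c : trig_closure (fun=> c).
Proof.
suff: trig_closure (fun x => (c - 1) * cos (\sum_i 0 * x i + 0) +
    cos (\sum_i 0 * x i + 0)).
  by apply: trig_eq => x; rewrite big1 ?addr0 ?cos0 => [|i _]; rewrite ?mul0r//; ring.
apply: trig_lin; exact: (trig_cos (fun=> 0)).
Qed.

Lemma trigD F G : trig_closure F -> trig_closure G ->
  trig_closure (fun x => F x + G x).
Proof.
by move=> hF hG; apply: (trig_eq _ (trig_lin 1 hF hG)) => x; rewrite mul1r.
Qed.

Lemma trigZ c F : trig_closure F -> trig_closure (fun x => c * F x).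
Proof.
by move=> hF; apply: (trig_eq _ (trig_lin c hF (trig_cst 0))) => x; rewrite addr0.
Qed.

Lemma trig_bounded F : trig_closure F -> exists C, forall x, `|F x| <= C.
Proof.
elim => [w b|c F1 F2 _ [C1 h1] _ [C2 h2]|F_ F1 C _ _ hC hF].
- by exists 1 => x; rewrite ler_norml cos_geN1 cos_le1.
- exists (`|c| * C1 + C2) => x; rewrite (le_trans (ler_normD _ _))// lerD//.
  by rewrite normrM ler_wpM2l.
- exists C => x; have /cvg_norm cF := hF x.
  by apply: (ler_cvg_to cF (cvg_cst C)); exact: nearW.
Qed.

(** Induction on [F] with [G] fixed, then on [G] with [F] a cosine. Boundedness of the fixed factor
    keeps the products uniformly bounded in the limit case. *)
Lemma trigM F G : trig_closure F -> trig_closure G ->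
  trig_closure (fun x => F x * G x).
Proof.
move=> hF hG; have [D hD] := trig_bounded hG.
have D0 : 0 <= D := le_trans (normr_ge0 _) (hD (fun=> 0)).
elim: hF => [w b|c F1 F2 _ h1 _ h2|F_ F1 C _ h hC hF]; last first.
- apply: (trig_lim (F_ := fun n x => F_ n x * G x) (C := C * D)) => // [n x|x].
    by rewrite normrM ler_pM.
  by apply: cvgM; [exact: hF|exact: cvg_cst].
- by apply: (trig_eq _ (trig_lin c h1 h2)) => x; ring.
elim: hG {D D0 hD} => [v a|c F1 F2 _ h1 _ h2|F_ F1 C _ h hC hF]; last first.
- apply: (trig_lim (F_ := fun n x => cos (\sum_i w i * x i + b) * F_ n x) (C := C)) => //.
    move=> n x; rewrite normrM (le_trans _ (hC n x))// ler_piMl//.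
    by rewrite ler_norml cos_geN1 cos_le1.
  by move=> x; apply: cvgM; [exact: cvg_cst|exact: hF].
- by apply: (trig_eq _ (trig_lin c h1 h2)) => x; ring.
(* Product-to-sum: cos p cos q is half of cos (p + q) + cos (p - q). *)
have hs := trig_cos (fun i => w i + v i) (b + a).
have hd := trig_cos (fun i => w i - v i) (b - a).
apply: (trig_eq _ (trigZ 2^-1 (trigD hs hd))) => x /=.
have -> : \sum_i (w i + v i) * x i + (b + a) =
    (\sum_i w i * x i + b) + (\sum_i v i * x i + a).
  by under eq_bigr do rewrite mulrDl; rewrite big_split/=; ring.
have -> : \sum_i (w i - v i) * x i + (b - a) =
    (\sum_i w i * x i + b) - (\sum_i v i * x i + a).
  by under eq_bigr do rewrite mulrBl; rewrite sumrB; ring.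
by rewrite cosD cosB; field.
Qed.

Lemma trig_prod (J : Type) (s : seq J) (F : J -> (I -> R) -> R) :
  (forall j, trig_closure (F j)) -> trig_closure (fun x => \prod_(j <- s) F j x).
Proof.
move=> hF; elim: s => [|j s IH].
  by apply: (trig_eq _ (trig_cst 1)) => x; rewrite big_nil.
by apply: (trig_eq _ (trigM (hF j) IH)) => x; rewrite big_cons.
Qed.

End trig_closure.

(** * Approximation of the sign function *)

Section sign_approximation.
Context {R : realType}.

(* A polynomial self-map of [-1, 1] with fixed points -1, 0, 1, attracted to
   the sign of the starting point. *)
Definition smoothstep (y : R) : R := (3 * y - y ^+ 3) / 2.

Lemma iter_smoothstepN n y : iter n smoothstep (- y) = - iter n smoothstep y.
Proof.
by elim: n => // n IH; rewrite !iterS IH /smoothstep exprNn; ring.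
Qed.

(** If z is the current iterate, one step multiplies 1 - z by 1 - (z + z^2) / 2, and this factor is
    at most 1 - y / 2 because z >= y. Hence geometric convergence to 1 when y > 0. *)
Lemma iter_smoothstep_ge n y : 0 <= y <= 1 ->
  y <= iter n smoothstep y <= 1 /\
  1 - iter n smoothstep y <= (1 - y / 2) ^+ n.
Proof.
move=> /andP[y0 y1]; elim: n => [|n [/andP[IH1 IH2] IH3]].
  by rewrite /= lexx y1 expr0 lerBlDr lerDl.
rewrite iterS /smoothstep; set z := iter n _ y in IH1 IH2 IH3 *.
have z0 : 0 <= z := le_trans y0 IH1.
have e : 1 - (3 * z - z ^+ 3) / 2 = (1 - z) * (1 - (z + z ^+ 2) / 2) by field.
have e2 : (3 * z - z ^+ 3) / 2 - z = z * ((1 - z) * (1 + z)) / 2 by field.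
have z20 := sqr_ge0 z.
have h1 : 0 <= (1 - z) * (1 - (z + z ^+ 2) / 2).
  by rewrite mulr_ge0//; nra.
split.
  rewrite -(subr_ge0 _ 1) e h1 andbT (le_trans IH1)// -subr_ge0 e2.
  by rewrite !mulr_ge0//; lra.
rewrite e [leRHS]exprSr ler_pM//; first lra.
- by nra.
- by lra.
Qed.

Lemma cvg_iter_smoothstep y : -1 <= y <= 1 ->
  iter n smoothstep y @[n --> \oo] --> Num.sg y.
Proof.
have pos z : 0 < z <= 1 -> iter n smoothstep z @[n --> \oo] --> (1 : R).
  move=> /andP[z0 z1].
  apply: (@squeeze_cvgr _ _ _ _ (fun n => 1 - (1 - z / 2) ^+ n) (cst 1)).
  - apply: nearW => n; have [] := @iter_smoothstep_ge n z _; first by rewrite ltW.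
    by move=> /andP[_ h1] h2; rewrite /= h1 andbT; lra.
  - rewrite -[X in _ --> X]subr0; apply: cvgB; first exact: cvg_cst.
    by apply: cvg_expr; rewrite ger0_norm; lra.
  - exact: cvg_cst.
move=> /andP[yN1 y1]; case: (sgrP y) => [->|y0|y0].
- have -> : (fun n => iter n smoothstep 0) = (fun=> 0 : R).
    apply/funext; elim=> // n IH; rewrite iterS IH /smoothstep.
    by rewrite expr0n/=; ring.
  exact: cvg_cst.
- by apply: pos; rewrite y0.
- rewrite -[y]opprK.
  have -> : (fun n => iter n smoothstep (- - y)) = (fun n => - iter n smoothstep (- y)).
    by apply/funext => n; rewrite iter_smoothstepN.
  by apply: cvgN; apply: pos; lra.
Qed.

(** For n large the scaled argument lies in ]-pi, pi[, where the sine has the sign of its argument,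
    so the sequence is eventually constant. *)
Lemma cvg_sg_sin (x : R) : Num.sg (sin (n.+1%:R^-1 * x)) @[n --> \oo] --> Num.sg x.
Proof.
apply: cvg_near_cst.
have h : n.+1%:R^-1 * x @[n --> \oo] --> 0.
  rewrite -[X in _ --> X](mul0r x); apply: cvgM; last exact: cvg_cst.
  exact: (@cvg_harmonic R).
have pi0 := pi_gt0 R.
have h1 : \forall n \near \oo, n.+1%:R^-1 * x < pi by exact: (cvgr_lt _ h).
have h2 : \forall n \near \oo, - pi < n.+1%:R^-1 * x.
  by apply: (cvgr_gt _ h); rewrite oppr_lt0.
near=> n.
have k0 : 0 < n.+1%:R^-1 :> R by rewrite invr_gt0.
have a1 : n.+1%:R^-1 * x < pi by near: n.
have a2 : - pi < n.+1%:R^-1 * x by near: n.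
case: (sgrP x) => [->|x0|x0]; first by rewrite mulr0 sin0 sgr0.
  by rewrite gtr0_sg// sin_gt0_pi// mulr_gt0.
rewrite ltr0_sg// -[_ * x]opprK sinN oppr_lt0 sin_gt0_pi//.
by rewrite oppr_gt0 pmulr_rlt0// x0 ltrNl.
Unshelve. all: end_near. Qed.

End sign_approximation.

(** * Indicators of half-spaces *)

Section halfspaces.
Context {R : realType} {I : finType}.

Lemma trig_iter_smoothstep n (F : (I -> R) -> R) : trig_closure F ->
  trig_closure (fun x => iter n smoothstep (F x)).
Proof.
move=> hF; elim: n => // n IH.
have h3 := trigM IH (trigM IH IH).
apply: (trig_eq _ (trigD (trigZ (3 / 2) IH) (trigZ (- 2^-1) h3))) => x.
by rewrite iterS /smoothstep; field.
Qed.

(** Two nested limits, with y = w.x + b: for fixed k the iterates of [smoothstep] send sin (y / (k +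
    1)) to its sign, and letting k grow gives the sign of y. *)
Lemma trig_sg (w : I -> R) b :
  trig_closure (fun x => Num.sg (\sum_i w i * x i + b)).
Proof.
apply: (trig_lim (C := 1) (F_ := fun k x =>
  Num.sg (sin (k.+1%:R^-1 * (\sum_i w i * x i + b))))).
- move=> k; apply: (trig_lim (F_ := fun n x => iter n smoothstep
    (sin (k.+1%:R^-1 * (\sum_i w i * x i + b)))) (C := 1)).
  + move=> n; apply: trig_iter_smoothstep.
    (* The phase [- pi / 2] turns the cosine into a sine. *)
    have := trig_cos (fun i => k.+1%:R^-1 * w i) (k.+1%:R^-1 * b - pi / 2).
    apply: trig_eq => x; rewrite -sinDpihalf; congr sin.
    rewrite mulrDr mulr_sumr.
    under eq_bigr do rewrite -mulrA.
    by rewrite addrA subrK.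
  + move=> n x; set y := sin _.
    have [y0|/ltW y0] := leP 0 y.
      have [] := @iter_smoothstep_ge _ n y _; first by rewrite y0 sin_le1.
      by move=> /andP[h1 h2] _; rewrite ger0_norm// (le_trans y0).
    have [] := @iter_smoothstep_ge _ n (- y) _.
      by rewrite oppr_ge0 y0 lerNl sin_geN1.
    move=> /andP[h1 h2] _; rewrite -normrN -iter_smoothstepN ger0_norm//.
    by rewrite (le_trans _ h1)// oppr_ge0.
  + by move=> x; apply: cvg_iter_smoothstep; rewrite sin_geN1 sin_le1.
- by move=> n x; rewrite normr_sg; case: eqP.
- by move=> x; exact: cvg_sg_sin.
Qed.

(** With s the sign of the affine form, the indicator is 1 - (s + s^2) / 2, and s^2 stays in the
    class by [trigM]. *)
Lemma trig_halfspace (w : I -> R) b :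
  trig_closure (fun x => (\sum_i w i * x i + b <= 0)%R%:R).
Proof.
have h := trig_sg w b.
apply: (trig_eq _ (trigD (trig_cst 1)
  (trigZ (- 2^-1) (trigD h (trigM h h))))) => x /=.
by case: sgrP => _ /=; field.
Qed.

End halfspaces.

(** * Integrals determined by laws *)

Lemma bounded_integrable d (T : measurableType d) (R : realType)
    (P : probability T R) (f : T -> R) (C : R) :
  measurable_fun setT f -> (forall t, `|f t| <= C) ->
  P.-integrable setT (EFin \o f).
Proof.
move=> mf fC; apply: measurable_bounded_integrable => //.
  exact: (le_lt_trans (probability_le1 P measurableT) (ltry _)).
exists C; split; first exact: num_real.
by move=> M CM t _; apply: (le_trans (fC t)); exact: ltW.
Qed.

(* The display of [measurableTypeR R], on which Lebesgue measure lives, is not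
   convertible to that of [R]. *)
Lemma law_integral d (T : measurableType d) (R : realType)
    (P : probability T R) (X : {RV P >-> R})
    (nu : {measure set (measurableTypeR R) -> \bar R}) (f : R -> R) :
  (forall A : set R, measurable A -> P (X @^-1` A) = nu A) ->
  measurable_fun setT f -> P.-integrable setT (fun t => (f (X t))%:E) ->
  nu.-integrable setT (EFin \o f) /\
  (\int[P]_t (f (X t))%:E = \int[nu]_y (f y)%:E)%E.
Proof.
move=> Xnu mf0 intf.
have mX0 : measurable_fun (U := measurableTypeR R) setT X by exact: measurable_funP X.
pose X1 : {mfun T >-> measurableTypeR R} := HB.pack (X : T -> measurableTypeR R)
  (isMeasurableFun.Build _ _ _ (measurableTypeR R) _ mX0).
have mF : measurable_fun (T := measurableTypeR R) setT (EFin \o f).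
  exact/measurable_EFinP.
split; last first.
  rewrite -[LHS](integral_distribution (X := X1) mF)//.
  by apply: eq_measure_integral => A mA _; exact: Xnu.
apply/integrableP; split => //.
have /integrableP[_] := intf; apply: le_lt_trans; rewrite le_eqVlt; apply/orP; left.
apply/eqP; transitivity (\int[distribution P X1]_y `|(f y)%:E|)%E.
  by apply: eq_measure_integral => A mA _; rewrite -Xnu.
rewrite (ge0_integral_distribution X1 (f := abse \o (EFin \o f)))//.
  exact: measurableT_comp.
by move=> y; exact: abse_ge0.
Qed.

Lemma eq_law_integral d d' (T : measurableType d) (T' : measurableType d')
    (R : realType) (P : probability T R) (P' : probability T' R)
    (L : {RV P >-> R}) (L' : {RV P' >-> R}) (f : R -> R) :
  (forall A : set R, measurable A -> P (L @^-1` A) = P' (L' @^-1` A)) ->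
  measurable_fun setT f -> P.-integrable setT (fun t => (f (L t))%:E) ->
  P'.-integrable setT (fun t => (f (L' t))%:E) ->
  (\int[P]_t (f (L t))%:E = \int[P']_t (f (L' t))%:E)%E.
Proof.
move=> LL' mf iL iL'.
have mL' : measurable_fun (U := measurableTypeR R) setT L' by exact: measurable_funP L'.
pose L1 : {mfun T' >-> measurableTypeR R} := HB.pack (L' : T' -> measurableTypeR R)
  (isMeasurableFun.Build _ _ _ (measurableTypeR R) _ mL').
have [_ ->] := law_integral (nu := distribution P' L1) LL' mf iL.
have mF : measurable_fun (T := measurableTypeR R) setT (EFin \o f).
  exact/measurable_EFinP.
by rewrite -[RHS](integral_distribution (X := L1) mF).
Qed.

(** * The Cramer-Wold principle *)

Section cramer_wold.
Context (R : realType) (I : finType) d d' (T : measurableType d)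
  (T' : measurableType d') (P : probability T R) (P' : probability T' R)
  (X : I -> T -> R) (Y : I -> T' -> R).
Hypothesis mX : forall i, measurable_fun setT (X i).
Hypothesis mY : forall i, measurable_fun setT (Y i).
Hypothesis XY : forall (w : I -> R) (A : set R), measurable A ->
  P ((fun t => \sum_i w i * X i t) @^-1` A) =
  P' ((fun t => \sum_i w i * Y i t) @^-1` A).

Lemma measurable_trig d1 (S : measurableType d1) (W : I -> S -> R) F :
  (forall i, measurable_fun setT (W i)) -> trig_closure F ->
  measurable_fun setT (fun s => F (W ^~ s)).
Proof.
move=> mW; elim => [w b|c F1 F2 _ h1 _ h2|F_ F1 C _ h _ hF].
- apply: measurableT_comp; first exact: continuous_measurable_fun (@continuous_cos R).
  apply: measurable_funD => //; apply: measurable_sum => i.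
  exact: measurable_funM.
- by apply: measurable_funD => //; exact: measurable_funM.
- by apply: (measurable_fun_cvg (h := fun n s => F_ n (W ^~ s))) => // s _; exact: hF.
Qed.

(** Induction on [F]. The integral of a cosine depends only on the law of one linear form, where
    [XY] applies; the other two cases are linearity of the integral and dominated convergence. *)
Theorem cramer_wold F : trig_closure F ->
  (\int[P]_t (F (X ^~ t))%:E = \int[P']_t (F (Y ^~ t))%:E)%E.
Proof.
have int d1 (S : measurableType d1) (Q : probability S R) (W : I -> S -> R) G :
    (forall i, measurable_fun setT (W i)) -> trig_closure G ->
    Q.-integrable setT (EFin \o (fun s => G (W ^~ s))).
  move=> mW hG; have [C hC] := trig_bounded hG.
  apply: (@bounded_integrable _ _ _ _ (fun s => G (W ^~ s)) C).
    exact: measurable_trig mW hG.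
  by move=> s; exact: hC.
have mS d1 (S : measurableType d1) (W : I -> S -> R) (w : I -> R) :
    (forall i, measurable_fun setT (W i)) ->
    measurable_fun setT (fun s => \sum_i w i * W i s).
  by move=> mW; apply: measurable_sum => i; exact: measurable_funM.
elim => [w b|c F1 F2 hF1 h1 hF2 h2|F_ F1 C hF_ h hC hF].
- pose LX : {mfun T >-> R} := HB.pack (fun t => \sum_i w i * X i t)
    (isMeasurableFun.Build _ _ _ _ _ (mS _ _ X w mX)).
  pose LY : {mfun T' >-> R} := HB.pack (fun t => \sum_i w i * Y i t)
    (isMeasurableFun.Build _ _ _ _ _ (mS _ _ Y w mY)).
  have mc : measurable_fun setT (fun y : R => cos (y + b)).
    apply: measurableT_comp; first exact: continuous_measurable_fun (@continuous_cos R).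
    exact: measurable_funD.
  apply: (@eq_law_integral _ _ _ _ _ _ _ LX LY (fun y => cos (y + b))) => //=.
  + exact: XY.
  + exact: int _ _ P X _ mX (trig_cos w b).
  + exact: int _ _ P' Y _ mY (trig_cos w b).
- under eq_integral do rewrite EFinD EFinM.
  under [in RHS]eq_integral do rewrite EFinD EFinM.
  have iX1 := int _ _ P _ _ mX hF1; have iY1 := int _ _ P' _ _ mY hF1.
  have iX2 := int _ _ P _ _ mX hF2; have iY2 := int _ _ P' _ _ mY hF2.
  rewrite !integralD//; [|exact: integrableZl..].
  by rewrite !integralZl// h1 h2.
have hFt : trig_closure F1 by exact: trig_lim hC hF.
(* The dominating function is the constant [C], integrable for a probability. The space is generic
   so that the limit serves both [P] and [P']. *)
have lim d1 (S : measurableType d1) (Q : probability S R) (W : I -> S -> R) :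
    (forall i, measurable_fun setT (W i)) ->
    (\int[Q]_s (F_ n (W ^~ s))%:E)%E @[n --> \oo] --> (\int[Q]_s (F1 (W ^~ s))%:E)%E.
  move=> mW.
  have m1 n : measurable_fun setT (fun s => (F_ n (W ^~ s))%:E).
    by apply/measurable_EFinP; exact: measurable_trig.
  have m2 : measurable_fun setT (fun s => (F1 (W ^~ s))%:E).
    by apply/measurable_EFinP; exact: measurable_trig.
  have [|||_ _] := dominated_convergence (mu := Q) (g := cst C%:E) measurableT m1 m2.
  - by apply: aeW => s _; apply: cvg_EFin; [exact: nearW|exact: hF].
  - exact: finite_measure_integrable_cst.
  - by apply: aeW => s n _; rewrite lee_fin.
  - by [].
have /cvg_lim <- // := lim _ _ P _ mX; have /cvg_lim <- // := lim _ _ P' _ mY.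
by congr (limn _); apply/funext => n.
Qed.

End cramer_wold.

(** * Normal laws *)

Section normal.
Context {R : realType}.
Local Notation mu := (@lebesgue_measure R).

(** The Radon-Nikodym derivative of [normal_prob m s] agrees almost everywhere with
    [normal_pdf m s], both having the same integral over every measurable set. *)
Lemma normal_prob_integral (m s : R) (f : R -> \bar R) :
  (normal_prob m s).-integrable setT f ->
  (\int[normal_prob m s]_x f x = \int[mu]_x (f x * (normal_pdf m s x)%:E))%E.
Proof.
move=> intf; have mf := measurable_int _ intf.
have dom := normal_prob_dominates m s.
rewrite -(Radon_Nikodym_change_of_variables dom)//=.
have mpdf : measurable_fun setT (fun x => (normal_pdf m s x)%:E).
  by apply/measurable_EFinP; exact: measurable_normal_pdf.
apply: ae_eq_integral => //.
- exact: emeasurable_funM.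
- exact: emeasurable_funM.
- apply: ae_eqe_mul2l => /=.
  rewrite Radon_NikodymE//=.
  case: cid => /= h [h1 h2 h3].
  apply: integral_ae_eq => //=.
  by move=> E _ mE; rewrite -h3.
Qed.

(** The translated measure gives half-open intervals their length, and Lebesgue measure is unique
    with that property. *)
Lemma lebesgue_measure_shift (b : R) (A : set R) : measurable A ->
  mu ((fun x => x + b) @^-1` A) = mu A.
Proof.
move=> mA.
have mb : measurable_fun (T := measurableTypeR R) (U := measurableTypeR R) setT
    (fun x : R => x + b) by exact: measurable_funD.
pose sb : {mfun measurableTypeR R >-> measurableTypeR R} := HB.pack (fun x : R => x + b)
  (isMeasurableFun.Build _ _ _ _ _ mb).
suff H : forall X, ocitv X -> mu X = pushforward mu sb X.
  by rewrite (lebesgue_measure_unique H mA).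
move=> _ [[a c]] _ <-; rewrite /pushforward/=.
have -> : (fun x => x + b) @^-1` `]a, c]%classic = `]a - b, c - b]%classic.
  by apply/seteqP; split => x /=; rewrite !in_itv/= ltrBlDr lerBrDr.
rewrite !lebesgue_measure_itv/= !lte_fin ltrBlDr subrK.
by case: ifP => // _; congr EFin; ring.
Qed.

Lemma ge0_integral_shift (b : R) (A : set R) (f : R -> \bar R) : measurable A ->
  measurable_fun A f -> (forall x, A x -> (0 <= f x)%E) ->
  (\int[mu]_(x in (fun x => x + b)%R @^-1` A) f (x + b)%R = \int[mu]_(x in A) f x)%E.
Proof.
move=> mA mf f0.
have mb : measurable_fun (T := measurableTypeR R) (U := measurableTypeR R) setT
    (fun x : R => x + b) by exact: measurable_funD.
rewrite -(ge0_integral_pushforward mb mu mA mf)//.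
  by apply: eq_measure_integral => B mB _; exact: lebesgue_measure_shift.
by move=> x /set_mem; exact: f0.
Qed.

Lemma normal_pdf_shift (m s b x : R) : s != 0 ->
  normal_pdf (m + b) s (x + b) = normal_pdf m s x.
Proof. by move=> s0; rewrite !normal_pdfE// /normal_fun; congr (_ * expR _); field. Qed.

Lemma normal_prob_shift (m s b : R) (A : set R) : s != 0 -> measurable A ->
  normal_prob m s ((fun x => x + b) @^-1` A) = normal_prob (m + b) s A.
Proof.
move=> s0 mA; rewrite /normal_prob.
rewrite -(ge0_integral_shift b mA).
- by apply: eq_integral => x _; rewrite normal_pdf_shift.
- by apply/measurable_EFinP; apply: measurable_funTS; exact: measurable_normal_pdf.
- by move=> x _; rewrite lee_fin normal_pdf_ge0.
Qed.

(** Combined with [normal_prob_shift], this makes the law invariant under the reflection x |-> 2 m -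
    x, from which the mean is later found. *)
Lemma normal_probN (m s : R) (A : set R) : s != 0 -> measurable A ->
  normal_prob m s (-%R @^-1` A) = normal_prob (- m) s A.
Proof.
move=> s0 mA; rewrite /normal_prob.
have mN : measurable_fun (T := measurableTypeR R) (U := measurableTypeR R) setT
    (-%R : R -> R) by exact: oppr_measurable.
have mpdf : measurable_fun A (fun x => (normal_pdf (- m) s x)%:E).
  by apply/measurable_EFinP; apply: measurable_funTS; exact: measurable_normal_pdf.
transitivity (\int[mu]_(x in -%R @^-1` A) (normal_pdf (- m) s (- x))%:E)%E.
  apply: eq_integral => x _.
  by rewrite !normal_pdfE// /normal_fun -opprD sqrrN.
rewrite -(ge0_integral_pushforward mN mu mA mpdf)//.
  by apply: eq_measure_integral => B mB _; exact: lebesgue_measureN.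
by move=> x _; rewrite lee_fin normal_pdf_ge0.
Qed.

(** Needed because [is_gaussian] does not fix the sign of [s]. *)
Lemma normal_prob_normr (m s : R) : normal_prob m `|s| = normal_prob m s.
Proof.
have [->|s0] := eqVneq s 0; first by rewrite normr0.
apply/funext => A; rewrite /normal_prob; apply: eq_integral => x _.
by rewrite !normal_pdfE ?normr_eq0// /normal_fun /normal_peak real_normK ?num_real.
Qed.

(* The pointwise form of [1 + x <= expR x]; integrated, it bounds the variance
   by a function of t that is tight at t = 1, which pins the variance down. *)
Lemma normal_pdf_scale (s t x : R) : s != 0 -> 0 < t ->
  (1 + x ^+ 2 / (s ^+ 2 *+ 2)) * normal_pdf 0 s x <=
  t * normal_pdf 0 (t * s) x +
  (t ^- 2 * (x ^+ 2 / (s ^+ 2 *+ 2))) * normal_pdf 0 s x.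
Proof.
move=> s0 t0; have ts0 : t * s != 0 by rewrite mulf_neq0// gt_eqF.
rewrite (normal_pdfE _ s0) (normal_pdfE _ ts0) /normal_fun/= !subr0.
set y := x ^+ 2 / (s ^+ 2 *+ 2).
have -> : normal_peak (t * s) = t^-1 * normal_peak s.
  rewrite /normal_peak exprMn -mulrA -mulrnAr sqrtrM ?sqr_ge0// sqrtr_sqr.
  by rewrite gtr0_norm// invfM.
have -> : - x ^+ 2 / (s ^+ 2 *+ 2) = - y by rewrite mulNr.
have -> : - x ^+ 2 / ((t * s) ^+ 2 *+ 2) = - y + (y - t ^- 2 * y).
  by rewrite /y; field; rewrite s0 gt_eqF.
rewrite expRD; have := expR_ge1Dx (y - t ^- 2 * y).
set E := expR (y - _); set e := expR (- y) => h.
have e0 : 0 < e by exact: expR_gt0.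
have p0 := normal_peak_gt0 s0.
rewrite -subr_ge0 [X in 0 <= X](_ : _ =
  (normal_peak s * e) * (E - (1 + (y - t ^- 2 * y)))).
  by rewrite !mulr_ge0 ?subr_ge0// ltW.
by field; rewrite gt_eqF.
Qed.

(** The difference of the two sides is nonnegative and vanishes at t = 1, so its derivative there, 1
    - k, must be zero. Instead of differentiating, the proof clears denominators and contradicts the
    inequality at explicit points 1 + e and 1 - e. *)
Lemma scale_eq1 (k : R) :
  (forall t, 0 < t -> 1 + k / 2 <= t + t ^- 2 * (k / 2)) -> k = 1.
Proof.
move=> h.
have {}h t : 0 < t -> (t ^+ 2 - 1) * k <= 2 * (t - 1) * t ^+ 2.
  move=> t0; have t20 : 0 <= 2 * t ^+ 2 by rewrite mulr_ge0// sqr_ge0.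
  have := ler_wpM2r t20 (h _ t0).
  rewrite [leLHS](_ : _ = 2 * t ^+ 2 + k * t ^+ 2); last by field.
  rewrite [leRHS](_ : _ = 2 * t ^+ 3 + k); last by field; rewrite gt_eqF.
  by lra.
apply/eqP; rewrite eq_le; apply/andP; split; rewrite leNgt; apply/negP => k1.
(* At t = 1 + e the inequality, divided by e, reads k (2 + e) <= 2 (1 + e)^2. For this e the left
   side exceeds the right by e (3 k - 2 e), which is positive as e < 1 < k. *)
- pose e := (k - 1) / (k + 2).
  have e0 : 0 < e by rewrite divr_gt0; lra.
  have := h (1 + e); have -> : (1 + e) ^+ 2 - 1 = e * (2 + e) by ring.
  have -> : 2 * (1 + e - 1) * (1 + e) ^+ 2 = e * (2 * (1 + e) ^+ 2) by ring.
  rewrite -mulrA ler_pM2l// => /(_ (addr_gt0 ltr01 e0)).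
  have ek : e * (k + 2) = k - 1 by rewrite divfK//; lra.
  have e1 : e < 1 by rewrite ltr_pdivrMr; lra.
  by nra.
(* A first use of t = 1 / 2 gives k >= 0, so that e <= 1 / 4 below and 1 - e stays positive. *)
- have k0 : 0 <= k.
    have := h (1 / 2); have -> : (1 / 2 : R) ^+ 2 = 1 / 4 by field.
    move=> h2; have := h2 ltac:(lra); lra.
  pose e := (1 - k) / 4.
  have e0 : 0 < e by rewrite divr_gt0; lra.
  have e1 : e <= 1 / 4 by rewrite /e; lra.
  have := h (1 - e); have -> : (1 - e) ^+ 2 - 1 = - e * (2 - e) by ring.
  have -> : 2 * (1 - e - 1) * (1 - e) ^+ 2 = - e * (2 * (1 - e) ^+ 2) by ring.
  rewrite -mulrA !mulNr lerN2 ler_pM2l// => /(_ ltac:(lra)).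
  have ek : 1 - k = e * 4 by rewrite /e; lra.
  by nra.
Qed.

End normal.

(** * The variance of a centered normal law *)

Section gaussian.
Context {R : realType}.
Local Notation mu := (@lebesgue_measure R).

(** With q the second moment and k = q / s^2, integrating [normal_pdf_scale] gives 1 + k / 2 <= t +
    t^-2 k / 2 for all t > 0, and [scale_eq1] yields k = 1. *)
Lemma normal_prob_variance (s : R) : s != 0 ->
  (normal_prob 0 s).-integrable setT (fun x => (x ^+ 2)%:E) ->
  (\int[normal_prob 0 s]_x (x ^+ 2)%:E = (s ^+ 2)%:E)%E.
Proof.
move=> s0 int2; pose nu := normal_prob 0 s.
pose q := fine (\int[nu]_x (x ^+ 2)%:E).
have qE : (\int[nu]_x (x ^+ 2)%:E = q%:E)%E.
  by rewrite fineK//; exact: integrable_fin_num.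
have s20 : 0 < s ^+ 2 by rewrite exprn_even_gt0.
have eZ c : (fun x : R => (c * (x ^+ 2 / (s ^+ 2 *+ 2)))%:E) =
    (fun x => (c / (s ^+ 2 *+ 2))%:E * (x ^+ 2)%:E)%E.
  by apply/funext => x; rewrite -EFinM; congr EFin; rewrite mulrCA mulrC.
have intZ c : nu.-integrable setT (fun x => (c * (x ^+ 2 / (s ^+ 2 *+ 2)))%:E).
  by rewrite eZ; exact: integrableZl.
have qZ c : (\int[nu]_x (c * (x ^+ 2 / (s ^+ 2 *+ 2)))%:E = (c * (q / s ^+ 2 / 2))%:E)%E.
  by rewrite eZ integralZl// qE -EFinM; congr EFin; field; rewrite s0.
suff /eqP : q / s ^+ 2 = 1.
  by rewrite -subr_eq0 -(mulfV (lt0r_neq0 s20)) -mulrBl mulf_eq0 invr_eq0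
    (gt_eqF s20) orbF subr_eq0 => /eqP <-.
apply: scale_eq1 => t t0.
have ts0 : t * s != 0 by rewrite mulf_neq0// gt_eqF.
have mp r : measurable_fun (T := measurableTypeR R) setT
    (fun x : R => (normal_pdf 0 r x)%:E).
  by apply/measurable_EFinP; exact: measurable_normal_pdf.
have mq : measurable_fun (T := measurableTypeR R) setT
    (fun x : R => x ^+ 2 / (s ^+ 2 *+ 2)).
  by apply: measurable_funM => //; exact: measurable_funX.
have mq1 : measurable_fun (T := measurableTypeR R) setT
    (fun x : R => (1 + x ^+ 2 / (s ^+ 2 *+ 2))%:E).
  by apply/measurable_EFinP; exact: measurable_funD.
have mqt : measurable_fun (T := measurableTypeR R) setT
    (fun x : R => (t ^- 2 * (x ^+ 2 / (s ^+ 2 *+ 2)))%:E).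
  by apply/measurable_EFinP; exact: measurable_funM.
have y0 (x : R) : 0 <= x ^+ 2 / (s ^+ 2 *+ 2).
  by rewrite divr_ge0 ?sqr_ge0// mulrn_wge0// sqr_ge0.
have e1 : (fun x : R => (1 + x ^+ 2 / (s ^+ 2 *+ 2))%:E) =
    (fun x => (1 : R)%:E + (1 * (x ^+ 2 / (s ^+ 2 *+ 2)))%:E)%E.
  by apply/funext => x; rewrite mul1r.
have int1 : nu.-integrable setT (fun x => (1 + x ^+ 2 / (s ^+ 2 *+ 2))%:E).
  by rewrite e1; apply: integrableD => //; exact: finite_measure_integrable_cst.
have l1 : (\int[nu]_x (1 + x ^+ 2 / (s ^+ 2 *+ 2))%:E = (1 + q / s ^+ 2 / 2)%:E)%E.
  rewrite e1 integralD//; last exact: finite_measure_integrable_cst.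
  rewrite qZ mul1r (integral_cst (normal_prob 0 s) measurableT).
  rewrite EFinD -[in RHS](mule1 1%:E).
  by congr (_ * _ + _)%E; exact: (probability_setT (normal_prob 0 s)).
rewrite -lee_fin -l1 EFinD -qZ.
rewrite (normal_prob_integral int1) (normal_prob_integral (intZ _)).
(* The first term of the pointwise bound is t times a probability density. *)
have -> : t%:E = (\int[mu]_x (t%:E * (normal_pdf 0 (t * s) x)%:E))%E.
  rewrite ge0_integralZl_EFin ?ltW//.
    by rewrite integral_normal_pdf mule1.
  by move=> x _; rewrite lee_fin normal_pdf_ge0.
have mt : measurable_fun (T := measurableTypeR R) setT
    (fun x : R => t%:E * (normal_pdf 0 (t * s) x)%:E)%E.
  by apply: emeasurable_funM; [exact: measurable_cst|exact: mp].
have mtq := emeasurable_funM mqt (mp s).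
rewrite -ge0_integralD//.
- apply: ge0_le_integral => //.
  + by move=> x _; rewrite -EFinM lee_fin mulr_ge0 ?normal_pdf_ge0// addr_ge0.
  + exact: emeasurable_funM mq1 (mp s).
  + exact: emeasurable_funD mt mtq.
  + by move=> x _; rewrite -!EFinM -EFinD lee_fin; exact: normal_pdf_scale.
- by move=> x _; rewrite -EFinM lee_fin mulr_ge0 ?normal_pdf_ge0// ltW.
- move=> x _; rewrite -EFinM lee_fin mulr_ge0 ?normal_pdf_ge0// mulr_ge0//.
  by rewrite invr_ge0 exprn_ge0 ?ltW.
Qed.

End gaussian.

(** * Second moments and centered normal variables *)

Section second_moments.
Context {R : realType} d (T : measurableType d) (P : probability T R).

Lemma integrable_sqr (X : {RV P >-> R}) (q : R) :
  ('E_P[fun t => (X t ^+ 2)%R] = q%:E)%E ->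
  P.-integrable setT (fun t => (X t ^+ 2)%:E).
Proof.
rewrite unlock => Xq; apply/integrableP; split.
  by apply/measurable_EFinP; exact: measurable_funX.
under eq_integral do rewrite gee0_abs ?lee_fin ?sqr_ge0//.
by rewrite Xq ltry.
Qed.

(** Domination by |x y| <= x^2 + y^2. *)
Lemma integrable_mul (X Y : {RV P >-> R}) :
  P.-integrable setT (fun t => (X t ^+ 2)%:E) ->
  P.-integrable setT (fun t => (Y t ^+ 2)%:E) ->
  P.-integrable setT (fun t => (X t * Y t)%:E).
Proof.
move=> iX iY; apply: le_integrable (integrableD measurableT iX iY) => //.
  by apply/measurable_EFinP; exact: measurable_funM.
move=> t _ /=; rewrite lee_fin [leRHS]ger0_norm ?addr_ge0 ?sqr_ge0//.
by rewrite ler_norml; have := sqr_ge0 (X t - Y t); have := sqr_ge0 (X t + Y t); nra.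
Qed.

Lemma integrable_of_sqr (X : {RV P >-> R}) :
  P.-integrable setT (fun t => (X t ^+ 2)%:E) ->
  P.-integrable setT (fun t => (X t)%:E).
Proof.
move=> iX.
have i1 : P.-integrable setT (fun=> 1%:E) :=
  finite_measure_integrable_cst P 1 measurableT.
apply: le_integrable (integrableD measurableT i1 iX) => //.
  exact/measurable_EFinP.
move=> t _ /=; rewrite lee_fin [leRHS]ger0_norm ?addr_ge0 ?sqr_ge0//.
by rewrite ler_norml; have := sqr_ge0 (X t - 1); have := sqr_ge0 (X t + 1); nra.
Qed.

Variables (I : finType) (X : I -> {RV P >-> R}) (c : I -> I -> R).
Hypothesis Xc : forall i j, ('E_P[fun t => (X i t * X j t)%R] = (c i j)%:E)%E.

Let int2 i : P.-integrable setT (fun t => (X i t ^+ 2)%:E).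
Proof. exact: integrable_sqr (Xc i i). Qed.

Lemma expectation_lincomb (w : I -> R) : (forall i, ('E_P[X i] = 0)%E) ->
  ('E_P[fun t => (\sum_i w i * X i t)%R] = 0)%E.
Proof.
move=> X0; rewrite unlock.
under eq_integral do rewrite -sumEFin.
have iX i : P.-integrable setT (fun t => (w i * X i t)%:E).
  under eq_fun do rewrite EFinM.
  by apply: integrableZl => //; exact: integrable_of_sqr.
rewrite integral_sum// big1// => i _.
under eq_integral do rewrite EFinM.
rewrite integralZl//; last exact: integrable_of_sqr.
by have := X0 i; rewrite unlock => ->; rewrite mule0.
Qed.

Lemma expectation_sqr_lincomb (w : I -> R) :
  ('E_P[fun t => ((\sum_i w i * X i t) ^+ 2)%R] =
    (\sum_i \sum_j w i * w j * c i j)%:E)%E.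
Proof.
rewrite unlock.
have iX i j : P.-integrable setT (fun t => (w i * w j * (X i t * X j t))%:E).
  under eq_fun do rewrite EFinM.
  by apply: integrableZl => //; exact: integrable_mul.
transitivity (\int[P]_t \sum_i \sum_j (w i * w j * (X i t * X j t))%:E)%E.
  apply: eq_integral => t _; rewrite expr2 mulr_suml -sumEFin; apply: eq_bigr => i _.
  by rewrite mulr_sumr -sumEFin; apply: eq_bigr => j _; congr EFin; ring.
rewrite integral_sum//; last by move=> i; exact: integrable_sum.
rewrite -sumEFin; apply: eq_bigr => i _; rewrite integral_sum// -sumEFin.
apply: eq_bigr => j _.
under eq_integral do rewrite EFinM.
rewrite integralZl//; last exact: integrable_mul.
by have := Xc i j; rewrite unlock => ->; rewrite -EFinM.
Qed.

End second_moments.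

(** Both parameters are read off from two moments: directly for a point mass; otherwise the mean
    from reflection symmetry and the standard deviation, up to sign, from [normal_prob_variance]. *)
Lemma centered_gaussian_law (R : realType) d (T : measurableType d)
    (P : probability T R) (X : {RV P >-> R}) (q : R) :
  is_gaussian P X -> ('E_P[X] = 0)%E -> ('E_P[fun t => (X t ^+ 2)%R] = q%:E)%E ->
  forall A : set R, measurable A -> P (X @^-1` A) = gaussian_law 0 (Num.sqrt q) A.
Proof.
move=> [m [s law]] X0 Xq A mA.
have iX2 := integrable_sqr Xq.
have iX := integrable_of_sqr iX2.
move: X0 Xq; rewrite unlock => X0 Xq.
have m2 : measurable_fun setT (fun x : R => x ^+ 2) by exact: measurable_funX.
rewrite law//; move: law; rewrite /gaussian_law; have [s0|s0] := eqVneq s 0 => law.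
  pose dm : {measure set (measurableTypeR R) -> \bar R} := \d_(m : measurableTypeR R).
  have [_] := law_integral (nu := dm) law (@measurable_id _ R setT) iX.
  rewrite X0 integral_dirac//= diracE mem_set// mul1e => -[/esym m0].
  have [_] := law_integral (nu := dm) law m2 iX2.
  rewrite Xq integral_dirac//=; last exact/measurable_EFinP.
  rewrite diracE mem_set// mul1e => -[->].
  by rewrite m0 expr0n/= sqrtr0 eqxx.
(* The variable [Y] = 2 m - [X] has the law of [X], hence the same expectation 0, while by linearity
   its expectation is 2 m. *)
have m0 : m = 0.
  have mY : measurable_fun setT (fun t => - X t + (m + m)).
    by apply: measurable_funD => //; exact: measurable_funN.
  pose Y : {mfun T >-> R} := HB.pack (fun t => - X t + (m + m))
    (isMeasurableFun.Build _ _ _ _ _ mY).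
  have lawY (B : set R) : measurable B -> P (X @^-1` B) = P (Y @^-1` B).
    move=> mB.
    have mB1 : measurable ((fun x : R => x + (m + m)) @^-1` B).
      by rewrite -[X in measurable X]setTI; exact: measurable_funD.
    have mB2 : measurable (-%R @^-1` ((fun x : R => x + (m + m)) @^-1` B)).
      by rewrite -[X in measurable X]setTI; exact: oppr_measurable.
    rewrite (_ : Y @^-1` B = X @^-1` (-%R @^-1` ((fun x : R => x + (m + m)) @^-1` B)))//.
    rewrite !law// normal_probN// normal_prob_shift//; congr (normal_prob _ _ _); ring.
  have iY : P.-integrable setT (fun t => (Y t)%:E).
    have -> : (fun t => (Y t)%:E) = (fun t => - (X t)%:E + (m + m)%:E)%E by [].
    apply: integrableD => //; first exact: integrableN.
    exact: finite_measure_integrable_cst.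
  have := eq_law_integral lawY (@measurable_id _ R setT) iX iY.
  rewrite X0; under eq_integral do rewrite EFinD EFinN.
  rewrite integralD//; [|exact: integrableN|exact: finite_measure_integrable_cst].
  rewrite integralN; last exact: integrable_add_def.
  rewrite X0 oppe0 add0e integral_cst// [X in (_ * X)%E](_ : _ = 1%E);
    last exact: probability_setT.
  rewrite mule1 => -[].
  by lra.
rewrite m0 in law *.
have [i2] := law_integral (nu := normal_prob 0 s) law m2 iX2.
rewrite Xq normal_prob_variance// => -[->].
by rewrite sqrtr_sqr normr_eq0 (negbTE s0) normal_prob_normr.
Qed.

(** * Sums of independent centered normal variables *)

Lemma gaussian_law_normr (R : realType) (m s : R) :
  gaussian_law m `|s| = gaussian_law m s.
Proof. by rewrite /gaussian_law normr_eq0 normal_prob_normr. Qed.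

(** Bayes' formula, by completing the square: for y of law N(0, a^2) and z of law N(y, b^2) given y,
    the joint density is the marginal of z times the density of y given z. *)
Lemma normal_pdfM (R : realType) (a b c y z : R) : a != 0 -> b != 0 -> 0 < c ->
  c ^+ 2 = a ^+ 2 + b ^+ 2 ->
  normal_pdf y b z * normal_pdf 0 a y =
  normal_pdf 0 c z * normal_pdf (z * a ^+ 2 / c ^+ 2) (a * b / c) y.
Proof.
move=> a0 b0 c0 cE.
have c0' : c != 0 by rewrite gt_eqF.
rewrite !normal_pdfE//; last by rewrite !mulf_neq0// invr_neq0.
have e : normal_fun y b z * normal_fun 0 a y =
    normal_fun 0 c z * normal_fun (z * a ^+ 2 / c ^+ 2) (a * b / c) y.
  rewrite /normal_fun -!expRD; congr expR.
  have bE : b ^+ 2 = c ^+ 2 - a ^+ 2 by rewrite cE; ring.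
  rewrite !exprMn exprVn bE.
  have b20 : c ^+ 2 - a ^+ 2 != 0 by rewrite -bE expf_eq0.
  by field; rewrite a0 c0' b20.
have p : normal_peak b * normal_peak a = normal_peak c * normal_peak (a * b / c).
  rewrite /normal_peak -!invfM -!sqrtrM; last 2 first.
  - by rewrite mulrn_wge0// mulr_ge0 ?sqr_ge0 ?pi_ge0.
  - by rewrite mulrn_wge0// mulr_ge0 ?sqr_ge0 ?pi_ge0.
  by congr (_^-1); congr Num.sqrt; field.
by rewrite mulrACA e p mulrACA.
Qed.

Section gaussian_sum.
Context (R : realType) d d' (T : measurableType d) (T' : measurableType d')
  (P : probability T R) (P' : probability T' R).
Local Notation mu := (@lebesgue_measure R).

Lemma integral_normal_pdf_mean (A : {RV P >-> R}) (a b z : R) : b != 0 ->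
  (forall S : set R, measurable S -> P (A @^-1` S) = gaussian_law 0 a S) ->
  (\int[P]_x (normal_pdf (A x) b z)%:E =
    (normal_pdf 0 (Num.sqrt (a ^+ 2 + b ^+ 2)) z)%:E)%E.
Proof.
move=> b0 lawA.
(* Exchanging mean and argument makes the integrand a fixed function of [A x], so that its integral
   depends only on the law of [A]. *)
have sym y : normal_pdf y b z = normal_pdf z b y.
  by rewrite !normal_pdfE// /normal_fun -sqrrN opprB.
under eq_integral do rewrite sym.
have mf : measurable_fun setT (normal_pdf z b) := measurable_normal_pdf z b.
have if_ : P.-integrable setT (fun x => (normal_pdf z b (A x))%:E).
  apply: (@bounded_integrable _ _ _ _ (normal_pdf z b \o A) (normal_peak b)).
    exact: measurableT_comp.
  by move=> x /=; rewrite ger0_norm ?normal_pdf_ge0// normal_pdf_ub.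
move: lawA; rewrite /gaussian_law; have [->|a0] := eqVneq a 0 => lawA.
  pose d0 : {measure set (measurableTypeR R) -> \bar R} := \d_(0 : measurableTypeR R).
  have [_ ->] := law_integral (nu := d0) lawA mf if_.
  rewrite integral_dirac//=; last exact/measurable_EFinP.
  rewrite diracE mem_set// mul1e expr0n/= add0r sqrtr_sqr -sym.
  by rewrite !normal_pdfE ?normr_eq0// /normal_fun /normal_peak real_normK ?num_real.
have [inu ->] := law_integral (nu := normal_prob 0 a) lawA mf if_.
rewrite (normal_prob_integral inu).
set c := Num.sqrt _.
have ab0 : 0 < a ^+ 2 + b ^+ 2 by rewrite ltr_pwDl ?sqr_ge0// exprn_even_gt0.
have c0 : 0 < c by rewrite sqrtr_gt0.
have cE : c ^+ 2 = a ^+ 2 + b ^+ 2 by rewrite sqr_sqrtr// ltW.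
transitivity (\int[mu]_y ((normal_pdf 0 c z)%:E *
    (normal_pdf (z * a ^+ 2 / c ^+ 2) (a * b / c) y)%:E))%E.
  by apply: eq_integral => y _ /=; rewrite -!EFinM -sym (normal_pdfM _ _ a0 b0 c0 cE).
rewrite ge0_integralZl_EFin ?normal_pdf_ge0//.
- by rewrite integral_normal_pdf mule1.
- by move=> y _; rewrite lee_fin normal_pdf_ge0.
- by apply/measurable_EFinP; exact: measurable_normal_pdf.
Qed.

(** The product measure encodes independence. Given the first point x, the sum is normal with mean
    [A x]; Fubini-Tonelli then averages its density over x. *)
Lemma gaussian_sum (A : {RV P >-> R}) (B : {RV P' >-> R}) (a b : R) :
  (forall S : set R, measurable S -> P (A @^-1` S) = gaussian_law 0 a S) ->
  (forall S : set R, measurable S -> P' (B @^-1` S) = gaussian_law 0 b S) ->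
  forall S : set R, measurable S ->
    (P \x P')%E ((fun z => A z.1 + B z.2) @^-1` S) =
    gaussian_law 0 (Num.sqrt (a ^+ 2 + b ^+ 2)) S.
Proof.
move=> lawA lawB S mS.
have mshift x : measurable ((fun y : R => y + A x) @^-1` S).
  by rewrite -[X in measurable X]setTI; exact: measurable_funD.
transitivity (\int[P]_x gaussian_law 0 b ((fun y : R => y + A x)%R @^-1` S))%E.
  apply: eq_integral => x _; rewrite -lawB//; congr (P' _).
  by apply/seteqP; split => y; rewrite /xsection/= inE/= addrC.
(* For b = 0 there is no density: the inner term is the indicator of [A x] in [S]. *)
have [b0|b0] := eqVneq b 0.
  rewrite b0 expr0n/= addr0 sqrtr_sqr gaussian_law_normr -lawA//.
  have mAS : measurable (A @^-1` S).
    by rewrite -[X in measurable X]setTI; exact: (measurable_funP A).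
  rewrite -[X in P X]setIT -integral_indic//; apply: eq_integral => x _.
  rewrite /gaussian_law eqxx diracE indicE; congr ((nat_of_bool _)%:R%:E).
  by apply/idP/idP; rewrite !inE/= add0r.
have c0 : Num.sqrt (a ^+ 2 + b ^+ 2) != 0.
  by rewrite gt_eqF// sqrtr_gt0 ltr_wpDl ?sqr_ge0// exprn_even_gt0.
have normal_indic m s : normal_prob m s S = (\int[mu]_z (normal_pdf m s z * \1_S z)%:E)%E.
  rewrite /normal_prob integral_mkcond epatch_indic.
  by apply: eq_integral => z _; rewrite EFinM.
pose F (xz : T * measurableTypeR R) : \bar R :=
  (normal_pdf (A xz.1) b xz.2 * \1_S xz.2)%:E.
have mF : measurable_fun setT F.
  apply/measurable_EFinP; apply: measurable_funM; last first.
    by apply: measurableT_comp => //; exact: measurable_indic.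
  (* Joint measurability holds because the density depends only on the difference z - [A x]. *)
  have -> : (fun xz : T * measurableTypeR R => normal_pdf (A xz.1) b xz.2) =
      normal_pdf 0 b \o (fun xz => xz.2 - A xz.1).
    apply/funext => xz /=; rewrite -(normal_pdf_shift 0 (A xz.1))//.
    by rewrite add0r subrK.
  apply: measurableT_comp; first exact: measurable_normal_pdf.
  by apply: measurable_funB => //; exact: measurableT_comp.
have F0 xz : (0 <= F xz)%E by rewrite lee_fin mulr_ge0 ?normal_pdf_ge0.
transitivity (\int[P]_x \int[mu]_z F (x, z))%E.
  apply: eq_integral => x _; rewrite /gaussian_law (negbTE b0).
  by rewrite normal_prob_shift// add0r normal_indic.
rewrite (fubini_tonelli F)// /gaussian_law (negbTE c0) normal_indic.
apply: eq_integral => z _; rewrite /F/=.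
under eq_integral do rewrite EFinM.
rewrite ge0_integralZr//.
- by rewrite (integral_normal_pdf_mean _ b0 lawA) EFinM.
- apply/measurable_EFinP.
  have -> : (fun x => normal_pdf (A x) b z) = normal_pdf 0 b \o (fun x => z - A x).
    apply/funext => x /=; rewrite -(normal_pdf_shift 0 (A x))//.
    by rewrite add0r subrK.
  apply: measurableT_comp; first exact: measurable_normal_pdf.
  exact: measurable_funB.
- by move=> x _; rewrite lee_fin normal_pdf_ge0.
Qed.

End gaussian_sum.

(** * First exceedances *)

Lemma big_optionE (R : realType) (I : finType) (F : option I -> R) :
  \sum_i F i = F None + \sum_i F (Some i).
Proof.
rewrite (bigD1 None)//=; congr (_ + _).
rewrite (reindex_omap Some id) /=; last by case.
by apply: eq_bigl => i; rewrite eqxx.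
Qed.

(* [None] stands for the conditioning variable Z_m, [Some j] for Z_j, j < m. *)
Definition condition_index n (m : 'I_n) (i : option 'I_m) : 'I_n :=
  if i is Some j then below j else m.

Lemma below_neq n (m : 'I_n) (j : 'I_m) : below j != m.
Proof. by rewrite -val_eqE/= ltn_eqF. Qed.

(** * Linear combinations of jointly normal variables *)

Section jointly_gaussian_theory.
Context (R : realType) d (T : measurableType d) (P : probability T R) (n : nat)
  (Z : 'I_n -> {RV P >-> R}) (c : 'I_n -> 'I_n -> R).
Hypothesis Zgauss : jointly_gaussian Z.
Hypothesis Z0 : forall i, ('E_P[Z i] = 0)%E.
Hypothesis Zc : forall i j, ('E_P[fun t => (Z i t * Z j t)%R] = (c i j)%:E)%E.

Variables (I : finType) (f : I -> 'I_n) (w : I -> R).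

Lemma measurable_lincomb : measurable_fun setT (fun t => \sum_i w i * Z (f i) t).
Proof. by apply: measurable_sum => i; exact: measurable_funM. Qed.

(** The reindexing [f] lets one lemma serve for all variables, for a subfamily and for a single one;
    weights are summed over the fibres of [f] to meet the definition of joint normality. *)
Lemma lincomb_law (S : set R) : measurable S ->
  P ((fun t => \sum_i w i * Z (f i) t) @^-1` S) =
  gaussian_law 0 (Num.sqrt (\sum_i \sum_j w i * w j * c (f i) (f j))) S.
Proof.
pose L : {mfun T >-> R} := HB.pack (fun t => \sum_i w i * Z (f i) t)
  (isMeasurableFun.Build _ _ _ _ _ measurable_lincomb).
apply: (centered_gaussian_law (X := L)).
- have := Zgauss (fun k => \sum_(i | f i == k) w i).
  rewrite (_ : (fun t => _) = L)//; apply/funext => t /=.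
  rewrite [RHS](partition_big f predT)//=; apply: eq_bigr => k _.
  by rewrite mulr_suml; apply: eq_bigr => i /eqP <-.
- exact: (expectation_lincomb (X := fun i => Z (f i)) (fun i j => Zc (f i) (f j))).
- exact: (expectation_sqr_lincomb (X := fun i => Z (f i)) (fun i j => Zc (f i) (f j))).
Qed.

Lemma lincomb_variance_ge0 : 0 <= \sum_i \sum_j w i * w j * c (f i) (f j).
Proof.
rewrite -lee_fin.
rewrite -(expectation_sqr_lincomb (X := fun i => Z (f i)) (fun i j => Zc (f i) (f j)) w).
by apply: expectation_ge0 => t; exact: sqr_ge0.
Qed.

End jointly_gaussian_theory.

(** * Exceedance events as bounded limits *)

Section exceedance.
Context (R : realType) (I : finType).
Implicit Types (u : R).

(** Written as a polynomial in half-space indicators, so that membership in [trig_closure] follows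
    from closure under products. *)
Definition exceed u (x : option I -> R) : R :=
  (1 - (x None - u <= 0)%R%:R) * \prod_(j : I) (x (Some j) - u <= 0)%R%:R.

Lemma trig_exceed u : trig_closure (exceed u).
Proof.
have h i : trig_closure (fun x : option I -> R => (x i - u <= 0)%R%:R).
  apply: trig_eq (trig_halfspace (fun k => (k == i)%:R) (- u)) => x.
  rewrite (bigD1 i)//= eqxx mul1r big1 ?addr0// => k /negbTE ->.
  by rewrite mul0r.
apply: trigM; last by apply: trig_prod.
by apply: trig_eq (trigD (trig_cst 1) (trigZ (-1) (h None))) => x; rewrite mulN1r.
Qed.

Lemma exceedE u x :
  exceed u x = \1_[set x | u < x None /\ forall j : I, x (Some j) <= u] x.
Proof.
rewrite indicE /exceed subr_le0.
have [h|h] := leP (x None) u.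
  rewrite subrr mul0r memNset//= => -[]; rewrite ltNge h//.
rewrite subr0 mul1r; have [/forallP h2|] := boolP [forall j : I, x (Some j) <= u].
  by rewrite mem_set//= big1// => j _; rewrite subr_le0 h2.
rewrite negb_forall => /existsP[j hj]; rewrite (bigD1 j)//= subr_le0 (negbTE hj) mul0r.
by rewrite memNset//= => -[_ /(_ j)]; rewrite (negbTE hj).
Qed.

Lemma measurable_exceed d (T : measurableType d) (W : option I -> T -> R) u :
  (forall i, measurable_fun setT (W i)) ->
  measurable [set t | u < W None t /\ forall j : I, W (Some j) t <= u].
Proof.
move=> mW.
have -> : [set t | u < W None t /\ forall j : I, W (Some j) t <= u] =
    (fun t => exceed u (W ^~ t)) @^-1` [set 1].
  apply/seteqP; split => t /=; rewrite exceedE indicE.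
    by move=> h; rewrite mem_set.
  by case: (boolP (_ \in _)) => [|_ /eqP]; [rewrite inE|rewrite eq_sym oner_eq0].
rewrite -[X in measurable X]setTI.
exact: (measurable_trig mW (trig_exceed u)).
Qed.

Lemma integral_exceed d (T : measurableType d) (P : probability T R)
    (W : option I -> T -> R) u : (forall i, measurable_fun setT (W i)) ->
  (\int[P]_t (exceed u (W ^~ t))%:E =
    P [set t | (u < W None t)%R /\ forall j : I, (W (Some j) t <= u)%R])%E.
Proof.
move=> mW; rewrite -[X in P X]setIT -integral_indic//; last exact: measurable_exceed.
by apply: eq_integral => t _; rewrite exceedE.
Qed.

End exceedance.

(** The standard normal density decreases on the nonnegative half-line, which contains the interval
    since u >= 0. *)
Lemma normal_prob_itv_ge (R : realType) (u H : R) : 0 <= u -> 0 <= H ->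
  ((H * expR (- (u + H) ^+ 2 / 2) / Num.sqrt (2 * pi))%:E <=
    gaussian_law 0 1 `]u, (u + H)%R]%classic)%E.
Proof.
move=> u0 H0; rewrite /gaussian_law oner_eq0 /normal_prob.
have pdfE x : normal_pdf 0 1 x = expR (- x ^+ 2 / 2) / Num.sqrt (2 * pi) :> R.
  rewrite normal_pdfE ?oner_eq0// /normal_peak /normal_fun expr1n mul1r subr0 mulrC.
  by rewrite mulr_natl.
apply: (@le_trans _ _ (\int[lebesgue_measure]_(x in `]u, (u + H)%R]%classic)
    (normal_pdf 0 1 (u + H))%:E)%E).
  rewrite integral_cst; last exact: measurable_itv.
  rewrite -[X in (_ <= _ * X)%E]/(lebesgue_measure `]u, (u + H)%R]%classic).
  rewrite lebesgue_measure_itv/= lte_fin ltrDl.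
  have [H1|H1] := ltP 0 H; last first.
    by rewrite (_ : H = 0) ?mul0r ?mule0//; apply/eqP; rewrite eq_le H0 H1.
  rewrite -EFinD -EFinM lee_fin pdfE (_ : u + H - u = H); last by ring.
  by rewrite [leRHS]mulrC mulrA.
apply: ge0_le_integral => //.
- by move=> x _; rewrite lee_fin normal_pdf_ge0.
- apply: measurable_funTS; apply/measurable_EFinP; exact: measurable_normal_pdf.
- move=> x; rewrite /= in_itv/= => /andP[ux xuH]; rewrite lee_fin !pdfE.
  rewrite ler_wpM2r ?invr_ge0// ler_expR ler_wpM2r// lerN2.
  by rewrite ler_sqr ?nnegrE ?(le_trans u0 (ltW ux)) ?addr_ge0.
Qed.

(** * The probability of one first exceedance *)

Section first_exceedance.
Context (R : realType) d (T : measurableType d) (P : probability T R) (n : nat)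
  (Z : 'I_n -> {RV P >-> R}) (r : 'I_n -> 'I_n -> R).
Hypothesis Zr : forall i j, ('E_P[fun t => (Z i t * Z j t)%R] = (r i j)%:E)%E.
Hypothesis Zgauss : jointly_gaussian Z.
Hypothesis Z0 : forall i, ('E_P[Z i] = 0)%E.
Hypothesis r1 : forall i, r i i = 1.
Hypothesis rsym : forall i j, r i j = r j i.
Hypothesis r_lt1 : forall i j, i != j -> `|r i j| < 1.
Context (m : 'I_n) d' (T' : measurableType d') (P' : probability T' R)
  (V : 'I_m -> {RV P' >-> R}).
Hypothesis Vgauss : jointly_gaussian V.
Hypothesis V0 : forall j, ('E_P'[V j] = 0)%E.
Hypothesis Vr : forall j k, ('E_P'[fun t => (V j t * V k t)%R] =
  (partial_corr r (below j) (below k) m)%:E)%E.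

Let rho (j : 'I_m) : R := r (below j) m.
Let sd (j : 'I_m) : R := Num.sqrt (1 - rho j ^+ 2).

Let sd_gt0 j : 0 < sd j.
Proof.
rewrite sqrtr_gt0 subr_gt0 -real_normK ?num_real// expr_lt1//.
by apply: r_lt1; exact: below_neq.
Qed.

Let X (i : option 'I_m) (t : T) : R := Z (condition_index i) t.

(** [V] is read on the second factor of the product space, which makes it independent of [Z m]. *)
Let Y (i : option 'I_m) (z : T * T') : R :=
  if i is Some j then rho j * Z m z.1 + sd j * V j z.2 else Z m z.1.

Let mX i : measurable_fun setT (X i).
Proof. exact: (measurable_funP (Z (condition_index i))). Qed.

Let mY i : measurable_fun setT (Y i).
Proof.
have m1 : measurable_fun setT (fun z : T * T' => Z m z.1) by exact: measurableT_comp.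
case: i => [j|//]; apply: measurable_funD; first exact: measurable_funM.
by apply: measurable_funM => //; exact: measurableT_comp.
Qed.

(** Equality of the variances of w.Y and w.X. After scaling by [sd], the covariances of the [V j]
    are r_{j,k} - rho_j rho_k, and the subtracted products are restored by the square of the
    coefficient of [Z m]. *)
Let variance_split (w : option 'I_m -> R) :
  (w None + \sum_j w (Some j) * rho j) ^+ 2 +
  \sum_j \sum_k (w (Some j) * sd j) * (w (Some k) * sd k) *
    partial_corr r (below j) (below k) m =
  \sum_i \sum_j w i * w j * r (condition_index i) (condition_index j).
Proof.
have pc j k : (w (Some j) * sd j) * (w (Some k) * sd k) *
    partial_corr r (below j) (below k) m =
    w (Some j) * w (Some k) * r (below j) (below k) -
    (w (Some j) * rho j) * (w (Some k) * rho k).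
  have := sd_gt0 j; have := sd_gt0 k; rewrite /partial_corr sqrtrM; last first.
    by rewrite ltW// -sqrtr_gt0; exact: sd_gt0.
  rewrite -/(rho j) -/(rho k) -/(sd j) -/(sd k) => sk sj.
  by field; rewrite !gt_eqF.
pose a := \sum_j w (Some j) * rho j.
have rhs : \sum_i \sum_j w i * w j * r (condition_index i) (condition_index j) =
    w None ^+ 2 + 2 * w None * a +
    \sum_j \sum_k w (Some j) * w (Some k) * r (below j) (below k).
  rewrite big_optionE big_optionE/= r1 mulr1.
  have -> : \sum_j w None * w (Some j) * r m (below j) = w None * a.
    by rewrite mulr_sumr; apply: eq_bigr => j _; rewrite rsym mulrA.
  under eq_bigr do rewrite big_optionE/=.
  rewrite big_split/=.
  have -> : \sum_j w (Some j) * w None * r (below j) m = w None * a.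
    by rewrite mulr_sumr; apply: eq_bigr => j _; rewrite /rho; ring.
  by ring.
rewrite rhs; under [X in _ + X = _]eq_bigr do under eq_bigr do rewrite pc.
under eq_bigr do rewrite sumrB -mulr_sumr.
by rewrite sumrB -mulr_suml -/a; ring.
Qed.

Let XY_law (w : option 'I_m -> R) (S : set R) : measurable S ->
  P ((fun t => \sum_i w i * X i t) @^-1` S) =
  (P \x P')%E ((fun z => \sum_i w i * Y i z) @^-1` S).
Proof.
move=> mS; rewrite (lincomb_law Zgauss Z0 Zr _ _ mS) -variance_split.
set b := w None + _.
(* The form w.Y splits into a multiple of [Z m] and a form in [V]. The one-term sum puts the
   multiple in the shape of [lincomb_law]. *)
pose A : {mfun T >-> R} := HB.pack (fun t => \sum_(i < 1) b * Z m t)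
  (isMeasurableFun.Build _ _ _ _ _ (measurable_lincomb Z (fun _ : 'I_1 => m) (fun=> b))).
pose B : {mfun T' >-> R} := HB.pack (fun t => \sum_j (w (Some j) * sd j) * V j t)
  (isMeasurableFun.Build _ _ _ _ _
    (measurable_lincomb V id (fun j => w (Some j) * sd j))).
have lawA := lincomb_law Zgauss Z0 Zr (fun _ : 'I_1 => m) (fun=> b).
have lawB := lincomb_law Vgauss V0 Vr id (fun j => w (Some j) * sd j).
have := gaussian_sum (A := A) (B := B) lawA lawB mS.
rewrite sqr_sqrtr; last exact: (lincomb_variance_ge0 Zr).
rewrite sqr_sqrtr; last exact: (lincomb_variance_ge0 Vr _ (fun j => w (Some j) * sd j)).
rewrite !big_ord1 r1 mulr1 -expr2 => <-; congr ((P \x P')%E (_ @^-1` S)).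
apply/funext => z /=; rewrite big_ord1 big_optionE/= /b mulrDl mulr_suml -addrA.
congr (_ + _); rewrite -big_split/=; apply: eq_bigr => j _; ring.
Qed.

Let exceedance_eq u :
  P [set t | u < Z m t /\ forall j : 'I_m, Z (below j) t <= u] =
  (P \x P')%E [set z | u < Y None z /\ forall j, Y (Some j) z <= u].
Proof.
rewrite -(integral_exceed P u mX) -(integral_exceed _ u mY).
exact: (cramer_wold mX mY XY_law (trig_exceed _ u)).
Qed.

(** On the product space the probability of [E] is the integral over t of the probability of its
    section. Only the t with u < [Z m t] <= u + H are kept, and there each section has probability
    at least the infimum. *)
Lemma first_exceedance_ge u H : 0 <= u -> 0 <= H ->
  ((H * expR (- (u + H) ^+ 2 / 2) / Num.sqrt (2 * pi))%:E *
     ereal_inf [set prob_below r u V h | h in `[0%R, H]] <=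
   P [set t | (u < Z m t)%R /\ forall j : 'I_m, (Z (below j) t <= u)%R])%E.
Proof.
move=> u0 H0; rewrite exceedance_eq; set iota := ereal_inf _.
set E := (X in (_ <= (P \x P') X)%E).
have mE : measurable E := measurable_exceed u mY.
have iota0 : (0 <= iota)%E by apply: le_ereal_inf_tmp => _ [h _ <-]; exact: measure_ge0.
pose D := Z m @^-1` `]u, (u + H)%R]%classic.
have mD : measurable D.
  by rewrite -[X in measurable X]setTI; exact: (measurable_funP (Z m)).
have PD : P D = gaussian_law 0 1 `]u, (u + H)%R]%classic.
  have := lincomb_law Zgauss Z0 Zr (fun _ : 'I_1 => m) (fun=> 1)
    (measurable_itv `]u, (u + H)%R]).
  rewrite !big_ord1 r1 !mulr1 sqrtr1 => <-; congr (P _).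
  by apply/seteqP; split => t /=; rewrite big_ord1 mul1r.
apply: (@le_trans _ _ (\int[P]_(t in D) iota)%E).
  rewrite integral_cst// [leRHS]muleC; apply: lee_wpmul2r => //.
  by rewrite [leRHS]PD; exact: normal_prob_itv_ge.
have mxs : measurable_fun setT (fun t => P' (xsection E t)).
  exact: measurable_fun_xsection.
apply: (@le_trans _ _ (\int[P]_(t in D) P' (xsection E t))%E).
  apply: ge0_le_integral => //.
  - exact: measurable_funTS.
  - move=> t; rewrite /D/= in_itv/= => /andP[ut tuH].
    (* With h = [Z m t] - u the section is the event of [prob_below], after multiplying by [sd j] >
       0. *)
    apply: ereal_inf_lbound; exists (Z m t - u).
      by rewrite /= in_itv/= subr_ge0 (ltW ut) lerBlDl.
    rewrite /prob_below; congr (P' _).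
    apply/seteqP; split => y; rewrite /xsection/= inE/=.
      move=> h; split=> // j; have := h j; rewrite subrKC.
      by rewrite ler_pdivlMr ?sd_gt0// mulrC lerBrDl.
    move=> [_ h] j; have := h j; rewrite subrKC.
    by rewrite ler_pdivlMr ?sd_gt0// mulrC lerBrDl.
(* The product measure of [E] is by definition the integral of its sections over the whole space. *)
apply: ge0_subset_integral => //.
Qed.

End first_exceedance.

(** * Partition by the first exceedance *)

Unset Implicit Arguments.
Set Strict Implicit.
Set Printing Implicit Defensive.

Theorem proposition1 (R : realType) (d : measure_display)
    (T : measurableType d) (P : probability T R)
    (n : nat) (hn : (1 <= n)%N) (Z : 'I_n -> {RV P >-> R})
    (r : 'I_n -> 'I_n -> R)
    (hr : forall i j : 'I_n,
      ('E_P[fun x => (Z i x * Z j x)%R] = (r i j)%:E)%E)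
    (hgauss : jointly_gaussian Z)
    (hmean : forall i : 'I_n, ('E_P[Z i] = 0)%E)
    (hnorm : forall i : 'I_n, ('E_P[fun x => (Z i x ^+ 2)%R] = 1)%E)
    (hcorr : forall i j : 'I_n, i != j -> `|r i j| < 1)
    (d' : 'I_n -> measure_display)
    (T' : forall m : 'I_n, measurableType (d' m))
    (P' : forall m : 'I_n, probability (T' m) R)
    (V : forall m : 'I_n, 'I_m -> {RV (P' m) >-> R})
    (hVgauss : forall m : 'I_n, jointly_gaussian (V m))
    (hVmean : forall (m : 'I_n) (j : 'I_m), ('E_(P' m)[V m j] = 0)%E)
    (hVvar : forall (m : 'I_n) (j : 'I_m), ('V_(P' m)[V m j] = 1)%E)
    (hVcorr : forall (m : 'I_n) (j k : 'I_m),
      ('E_(P' m)[fun x => (V m j x * V m k x)%R]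
         = (partial_corr r (below j) (below k) m)%:E)%E)
    (u H : R) (hu : 0 <= u) (hH : 0 <= H) :
  ((H * expR (- (u + H) ^+ 2 / 2) / Num.sqrt (2 * pi))%:E
     * \sum_(m < n) ereal_inf [set prob_below r u (V m) h | h in `[0%R, H]]
   <= P [set x | u%:E < \big[maxe/-oo]_(i < n) (Z i x)%:E])%E.
Proof.
pose A (m : 'I_n) := [set t | u < Z m t /\ forall j : 'I_m, Z (below j) t <= u].
have r1 i : r i i = 1.
  have e : (fun x => Z i x ^+ 2) = (fun x => Z i x * Z i x).
    by apply/funext => x; rewrite expr2.
  by apply: EFin_inj; rewrite -hr -e hnorm.
have rsym i j : r i j = r j i.
  have e : (fun x => Z i x * Z j x) = (fun x => Z j x * Z i x).
    by apply/funext => x; rewrite mulrC.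
  by apply: EFin_inj; rewrite -!hr e.
have mA m : measurable (A m).
  exact: (@measurable_exceed _ _ _ _ (fun i => Z (condition_index i)) u
    (fun i => measurable_funP (Z (condition_index i)))).
have tA : trivIset setT A.
  (* If i < j, then [A i] requires Z i > u and [A j] forbids it. *)
  suff lt (i j : 'I_n) t : (i < j)%N -> A i t -> A j t -> False.
    move=> i j _ _ [t [Ai Aj]]; apply: val_inj => /=.
    by case: (ltngtP i j) => // ij; [case: (lt i j t ij Ai Aj)|case: (lt j i t ij Aj Ai)].
  move=> ij [ui _] [_ /(_ (Ordinal ij))].
  rewrite (_ : below _ = i); last exact: val_inj.
  by rewrite leNgt ui.
have -> : [set x | (u%:E < \big[maxe/-oo]_(i < n) (Z i x)%:E)%E] =
    \big[setU/set0]_(m < n) A m.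
  rewrite -bigcup_seq.
  apply/seteqP; split => t /=.
    move=> ult; have [i0 hi0] : exists i, u < Z i t.
      apply: contrapT => /forallNP h; move: ult; apply/negP; rewrite -leNgt.
      (* The default value [-oo] of the maximum must also be bounded by u. *)
      apply/bigmax_leP; split; first exact: leNye.
      by move=> i _; rewrite lee_fin leNgt; apply/negP; exact: h.
    (* The least exceeding index selects the cell containing t. *)
    have [m hm hmin] := arg_minnP (P := fun i => u < Z i t) (fun i : 'I_n => i : nat) hi0.
    exists m; [exact: mem_index_enum|split => // j]; rewrite leNgt; apply/negP => uj.
    by have := hmin _ uj; rewrite leqNgt /= ltn_ord.
  move=> [m _ [um _]]; apply: (@lt_le_trans _ _ (Z m t)%:E); first by rewrite lte_fin.
  exact: (le_bigmax_cond _ (fun i => (Z i t)%:E)).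
rewrite [leRHS](measure_bigsetU_ord P xpredT mA tA) ge0_sume_distrr; last first.
  by move=> m _; apply: le_ereal_inf_tmp => _ [h _ <-]; exact: measure_ge0.
apply: lee_sum => m _.
exact: (first_exceedance_ge hr hgauss hmean r1 rsym hcorr (hVgauss m)
  (hVmean m) (hVcorr m) hu hH).
Qed.
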